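(* Let $q$ be a prime power and $n$ a positive integer. Let $\theta_1,\dots,\theta_n\in\mathbb{F}_{q^n}$, let $a_1,\dots,a_n\in\mathbb{F}_{q^n}$, let $m_1,\dots,m_n$ be positive integers, and let $$F(x)=a_1\mathrm{Tr}(\theta_1x)^{m_1}+\dots+a_n\mathrm{Tr}(\theta_nx)^{m_n}.$$ Then $F(x)$ is a permutation polynomial over $\mathbb{F}_{q^n}$ if and only if the following three conditions hold: (i) $\gcd(m_1\cdots m_n,q-1)=1$; (ii) $a_1,\dots,a_n$ is a basis of $\mathbb{F}_{q^n}$ over $\mathbb{F}_q$; (iii) $\theta_1,\dots,\theta_n$ is a basis of $\mathbb{F}_{q^n}$ over $\mathbb{F}_q$.
   Context: $\mathrm{Tr}(x)=x+x^q+\dots+x^{q^{n-1}}$ is the trace from $\mathbb{F}_{q^n}$ to $\mathbb{F}_q$. A polynomial in $\mathbb{F}_{q^n}[x]$ is a permutation polynomial over $\mathbb{F}_{q^n}$ if it induces a bijection of $\mathbb{F}_{q^n}$. *)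

(* Defs.v *)
From HB Require Import structures.
From mathcomp Require Import all_boot all_order all_algebra all_field.

Set Implicit Arguments.
Unset Strict Implicit.
Unset Printing Implicit Defensive.

Import GRing.Theory.
Local Open Scope ring_scope.

Definition permutation_poly (L : nzRingType) (p : {poly L}) : Prop :=
  bijective (fun x : L => p.[x]).

(* Tr is kept as a polynomial with coefficients in the large field L, so that
   its values lie in L (in the copy 1%AS of the base field). *)
Definition trace_poly (L : nzRingType) (q n : nat) : {poly L} :=
  \sum_(i < n) 'X^(q ^ i).

Definition trace_power_sum (L : fieldType) (q n : nat)
    (a theta : n.-tuple L) (m : n.-tuple nat) : {poly L} :=
  \sum_(i < n)
    tnth a i *: (trace_poly L q n \Po (tnth theta i *: 'X)) ^+ tnth m i.

(* Main.v *)
Require Import Defs.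
From HB Require Import structures.
From mathcomp Require Import all_boot all_order all_algebra all_field.
From mathcomp Require Import all_fingroup all_solvable.

Set Implicit Arguments.
Unset Strict Implicit.
Unset Printing Implicit Defensive.

Import GRing.Theory.
Local Open Scope ring_scope.

(* The polynomial map factors as x |-> (Tr(theta_i x))_i in F^n, then the
   coordinatewise powers c |-> c^(m_i), then (c_i)_i |-> sum_i c_i a_i.  As
   #|L| = #|F^n|, it is bijective iff each of the three maps is: the last iff
   a is a basis, the powers iff each m_i is coprime to q - 1, and the first
   iff theta is a basis, since Tr is a nonzero linear form. *)

Lemma coprime_prodn (I : finType) (m : I -> nat) (d : nat) :
  coprime (\prod_i m i) d <-> forall i, coprime (m i) d.
Proof.
split=> [cop i | cop].
  by apply: coprime_dvdl cop; rewrite (bigD1 i) //= dvdn_mulr.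
by elim/big_ind: _ => [|x y copx copy|i _]; rewrite ?coprime1n ?coprimeMl ?copx.
Qed.

(** If a prime [p] divides both [k] and the order of the unit group, Cauchy gives a unit of order
    [p], whose [k]-th power is that of 1. Otherwise the power map is invertible on units, and only 0
    is sent to 0. *)
Lemma finField_expr_inj (F : finFieldType) (k : nat) : (0 < k)%N ->
  injective (fun c : F => c ^+ k) <-> coprime k (#|F| - 1).
Proof.
move=> k_gt0; rewrite subn1 -card_finField_unit; split=> [inj_k | cop_k].
  apply: contraT => ncop.
  have /pdivP[p p_pr /[!dvdn_gcd]/andP[dvd_k dvd_F]] :
      (1 < gcdn k #|[set: {unit F}]|)%N.
    by rewrite ltn_neqAle eq_sym ncop gcdn_gt0 k_gt0.
  have [u _ ou] := @Cauchy _ p [set: {unit F}]%G p_pr dvd_F.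
  have uk : FinRing.uval u ^+ k = 1.
    rewrite -FinRing.val_unitX; apply/eqP.
    by move: dvd_k; rewrite -ou order_dvdn => /eqP->.
  have u1 : u = 1%g by apply/val_inj/inj_k; rewrite /= uk expr1n.
  by move: p_pr; rewrite -ou u1 order1.
move=> c d /= eq_cd; have [c0 | nz_c] := eqVneq c 0.
  move: eq_cd; rewrite c0 expr0n gtn_eqF // => /esym/eqP.
  by rewrite expf_eq0 k_gt0 => /eqP.
have nz_d : d != 0 by move: (expf_neq0 k nz_c); rewrite eq_cd expf_eq0 k_gt0.
suff: finField_unit nz_c = finField_unit nz_d by case.
rewrite coprime_sym in cop_k.
apply: (can_in_inj (expgK cop_k)); rewrite ?inE //.
by apply: val_inj; rewrite !FinRing.val_unitX.
Qed.

(** The Galois group is cyclic, generated by the Frobenius [alpha], and its order is the degree, so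
    the conjugates of [x] are listed by the powers of [alpha]. *)
Lemma horner_trace_poly (F : finFieldType) (L : splittingFieldType F) (x : L) :
  (trace_poly L #|F| (\dim {:L})).[x] = galTrace 1 {:L} x.
Proof.
have [alpha /eqP gen_alpha Dalpha] := finField_galois_generator (sub1v {:L}).
have Dexp i y : (alpha ^+ i)%g y = y ^+ (#|F| ^ i).
  elim: i y => [|i IHi] y; first by rewrite gal_id.
  rewrite expgSr galM ?memvf // IHi Dalpha ?memvf // dimv1 expn1.
  by rewrite expnSr exprM.
have ordL : \dim {:L} = #[alpha]%g.
  rewrite orderE -gen_alpha -galois_dim ?dimv1 ?divn1 //.
  by apply: finField_galois; apply: sub1v.
have DGal : 'Gal({:L} / 1)%g =i [set (alpha ^+ val i)%g | i : 'I_(\dim {:L})].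
  rewrite ordL => b; rewrite gen_alpha; apply/cycleP/imsetP=> [[i ->]|[i _ ->]].
    exists (Ordinal (ltn_pmod i (order_gt0 alpha))) => //=.
    by rewrite expg_mod_order.
  by exists i.
rewrite /galTrace (eq_bigl _ _ DGal) big_imset /=; last first.
  rewrite ordL => i j _ _ /eqP; rewrite eq_expg_mod_order.
  by rewrite !modn_small // => /eqP/val_inj.
by rewrite /trace_poly horner_sum; apply: eq_bigr => i _; rewrite hornerXn Dexp.
Qed.

Lemma galTraceZ (F : fieldType) (L : splittingFieldType F) (K E : {vspace L}) :
  scalable (galTrace K E).
Proof.
by move=> c x; rewrite scaler_sumr; apply: eq_bigr => s _; rewrite linearZ.
Qed.

(** The trace is Galois invariant, so it lands in the line [1%AS]; reading off the coordinate there
    gives a form with values in [F] itself. *)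
Lemma trace_scalar (F : finFieldType) (L : splittingFieldType F) :
  exists t : {scalar L},
    (forall x, (trace_poly L #|F| (\dim {:L})).[x] = (t x)%:A) /\
    exists x, t x != 0.
Proof.
have fix1 (x : L) : exists c, galTrace 1 {:L} x == c%:A.
  have /vlineP[c ->] : galTrace 1 {:L} x \in 1%AS; last by exists c.
  by apply: mem_galTrace; rewrite ?memvf // finField_galois ?sub1v.
pose t (x : L) : F^o := xchoose (fix1 x).
have tE x : galTrace 1 {:L} x = (t x)%:A by apply/eqP/(xchooseP (fix1 x)).
have t_lin : linear t.
  move=> c x y; apply: (fmorph_inj (in_alg L)); rewrite /= -tE raddfD /=.
  by rewrite galTraceZ !tE scalerDl -scalerA.
pose tL := GRing.isLinear.Build F L F^o _ t t_lin.
pose t' : {scalar L} := HB.pack t tL.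
exists t'; split=> [x|]; first by rewrite horner_trace_poly tE.
have := @gal_independent_contra _ _ {:L}%AS [in 'Gal({:L} / 1)%g] (fun=> 1) 1%g.
(* Dedekind: the trace is a nontrivial combination of automorphisms. *)
case=> [||x _ nz]; rewrite ?group1 ?oner_neq0 //; exists x.
apply: contraNneq nz => tx0; under eq_bigr do rewrite mul1r.
by rewrite -/(galTrace 1 {:L} x) tE [t x]tx0 scale0r.
Qed.

Theorem corollary1p1 (q n : nat) (n_gt0 : (0 < n)%N)
    (F : finFieldType) (cardF : #|F| = q)
    (L : fieldExtType F) (dimL : \dim {:L} = n)
    (theta a : n.-tuple L) (m : n.-tuple nat)
    (m_gt0 : forall i : 'I_n, (0 < tnth m i)%N) :
  permutation_poly (trace_power_sum q a theta m) <->
  [/\ gcdn (\prod_(i < n) tnth m i) (q - 1) = 1%N,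
      basis_of {:L} a
    & basis_of {:L} theta].
Proof.
have [t [/[1!cardF] /[1!dimL] tE [x0 tx0]]] :
    exists t : {scalar L},
      (forall x, (trace_poly L #|F| (\dim {:L})).[x] = (t x)%:A) /\
      exists x, t x != 0.
  (* Viewed as a finite field, [L] is a splitting field over [F]. *)
  exact: (trace_scalar (finvect_type L)).
set f := fun x : L => (trace_power_sum q a theta m).[x].
have fE x : f x = \sum_(i < n) t (theta`_i * x) ^+ tnth m i *: a`_i.
  rewrite /f /trace_power_sum horner_sum; apply: eq_bigr => i _.
  rewrite hornerZ horner_exp horner_comp hornerZ hornerX.
  rewrite [(_).[_]]tE !(tnth_nth 0) -[_%:A]/(in_alg L _) -rmorphXn /=.
  by rewrite -scalerAr mulr1.
have cardL : #|finvect_type L| = #|{ffun 'I_n -> F}|.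
  have <- : #|{: finvect_type L}%VS| = #|finvect_type L|.
    by rewrite card_vspacef.
  by rewrite card_vspace [\dim _]dimL card_ffun card_ord.
pose coords (x : L) := [ffun i : 'I_n => t (theta`_i * x)].
have copE : gcdn (\prod_(i < n) tnth m i) (q - 1) = 1%N <->
    forall i, injective (fun c : F => c ^+ tnth m i).
  split=> [/eqP/coprime_prodn cop i | inj].
    by apply/finField_expr_inj; rewrite ?cardF.
  by apply/eqP/coprime_prodn => i; rewrite -cardF; apply/finField_expr_inj.
split=> [bij_f | [/copE inj_m a_basis theta_basis]].
  (* [f] factors through [coords], which is therefore injective, and bijective by cardinality. *)
  have [h hK] : exists h : {ffun 'I_n -> F} -> L, cancel h coords.
    suff [h _ hK] : bijective (coords : finvect_type L -> _) by exists h.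
    apply: inj_card_bij; rewrite ?cardL // => x y /ffunP eq_xy.
    apply: (bij_inj bij_f); rewrite -!/(f _) !fE; apply: eq_bigr => i _.
    by have := eq_xy i; rewrite !ffunE => ->.
  have coord_h v (i : 'I_n) : t (theta`_i * h v) = v i.
    by have /ffunP/(_ i) := hK v; rewrite ffunE.
  split.
  - apply/copE => i c d eq_cd.
    (* Vectors supported at [i] isolate the [i]-th power map. *)
    pose v e := [ffun j => if j == i then e else 0 : F].
    suff /(can_inj hK)/ffunP/(_ i) : h (v c) = h (v d) by rewrite !ffunE eqxx.
    apply: (bij_inj bij_f); rewrite -!/(f _) !fE; apply: eq_bigr => j _.
    by rewrite !coord_h !ffunE; case: eqP => [->|//]; congr (_ *: _).
  (* All values of the surjective [f] lie in the span of [a]. *)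
  - rewrite basisEdim size_tuple dimL leqnn andbT; apply/subvP=> y _.
    have [f' _ f'K] := bij_f; rewrite -(f'K y) -/(f _) fE.
    apply: memv_suml => i _.
    by rewrite memvZ // memv_span // mem_nth ?size_tuple.
  rewrite basisEfree size_tuple dimL leqnn subvf !andbT.
  apply/freeP=> k sum0 i.
  (* Multiplying the relation by this dual vector [w] and applying [t] leaves only [k i]. *)
  pose w := h [ffun j => (j == i)%:R].
  have : t ((\sum_j k j *: theta`_j) * w) = 0 by rewrite sum0 mul0r raddf0.
  rewrite mulr_suml raddf_sum (bigD1 i) //= big1 => [|j /negPf ji].
    by rewrite addr0 -scalerAl linearZ /= coord_h ffunE eqxx mulr1.
  by rewrite -scalerAl linearZ /= coord_h ffunE ji mulr0.
suff inj_f : injective f.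
  exact: (injF_bij (inj_f : injective (f : finvect_type L -> _))).
move=> x y eq_xy; apply/eqP; rewrite -subr_eq0; apply: contraT => nz.
(* Freeness of [a] separates the terms of [f x = f y]; injective powers then give equal
   coordinates. *)
have theta0 (i : 'I_n) : t (theta`_i * (x - y)) = 0.
  rewrite mulrBr raddfB /=; apply/eqP; rewrite subr_eq0.
  apply/eqP/(inj_m i) => /=.
  have /freeP a_free := basis_free a_basis.
  apply/eqP; rewrite -subr_eq0; apply/eqP.
  pose e z (j : 'I_n) := t (theta`_j * z) ^+ tnth m j.
  apply: (a_free (fun j => e x j - e y j)).
  under eq_bigr do rewrite scalerBl.
  by rewrite sumrB -!fE [f x]eq_xy subrr.
(* Expanding [x0 / (x - y)] in the basis [theta] forces [t x0 = 0]. *)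
case/eqP: tx0; rewrite -(divfK nz x0).
rewrite (coord_basis theta_basis (memvf (x0 / (x - y)))).
rewrite mulr_suml raddf_sum big1 //= => i _.
by rewrite -scalerAl linearZ /= theta0 mulr0.
Qed.
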